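(* Let $b\in\mathbb{T}$ and $0<h<1$. Then the inclusion $S(b,h)\subset W(b,h)$ does not hold; that is, $S(b,h)$ is not a subset of $W(b,h)$.
   Context: $\mathbb{D}=\{z\in\mathbb{C}:|z|<1\}$ is the open unit disk and $\mathbb{T}=\{z\in\mathbb{C}:|z|=1\}$ is the unit circle. For $b\in\mathbb{T}$ and $0<h<1$, the Carleson set is $$S(b,h)=\{z\in\mathbb{D}:|z-b|<h\},$$ and the Carleson window is $$W(b,h)=\{z\in\mathbb{D}:|z|>1-h\ \text{and}\ z/|z|\in\overline{S(b,h)}\},$$ where $\overline{S(b,h)}$ is the closure of $S(b,h)$ in $\mathbb{C}$. The symbol $\subset$ denotes (not necessarily proper) inclusion. *)

(* Defs.v *)
From HB Require Import structures.
From mathcomp Require Import all_boot all_order all_algebra.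
From mathcomp Require Import complex.
From mathcomp Require Import classical_sets reals topology normedtype.

Set Implicit Arguments.
Unset Strict Implicit.
Unset Printing Implicit Defensive.

Import Order.TTheory GRing.Theory Num.Theory.
Import numFieldNormedType.Exports.

Local Open Scope classical_set_scope.
Local Open Scope ring_scope.
Local Open Scope complex_scope.

(* The modulus [`|z|] of [z : R[i]] is itself an element of [R[i]] (with zero
   imaginary part), hence the embedding [h%:C] of real radii below. *)

Definition unit_disk (R : realType) : set R[i] := [set z | `|z| < 1].

Definition unit_circle (R : realType) : set R[i] := [set z | `|z| = 1].

Definition carleson_set (R : realType) (b : R[i]) (h : R) : set R[i] :=
  [set z | unit_disk z /\ `|z - b| < h%:C].

(* The alias [R[i]^o] is what carries the norm topology of the complex plane,
   so [closure] is taken in the whole plane.  The point [z = 0], where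
   [z / `|z|] takes a junk value, is excluded by [1 - h < `|z|] when [h < 1]. *)
Definition carleson_window (R : realType) (b : R[i]) (h : R) : set R[i] :=
  [set z | [/\ unit_disk z, (1 - h)%:C < `|z|
             & closure (carleson_set b h : set R[i]^o) (z / `|z|)]].

(* Main.v *)
Require Import Defs.
From mathcomp Require Import all_boot all_order all_algebra.
From mathcomp Require Import complex.
From mathcomp Require Import classical_sets reals topology normedtype.
From mathcomp Require Import ring lra.

Import Order.TTheory GRing.Theory Num.Theory.
Import numFieldNormedType.Exports.

Local Open Scope classical_set_scope.
Local Open Scope ring_scope.
Local Open Scope complex_scope.

(** Every [w] in the closure of [carleson_set b h] satisfies [`|w - b| <= h], so
    it suffices to find [z] in the Carleson set whose radial projection onto the
    unit circle is at distance more than [h] from [b].  The ray through [u],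
    where [u = b * (c +i* s)] is at angle [theta] from [b] with [c = cos theta]
    and [s = sin theta], comes closest to [b] at its foot of perpendicular
    [z = c u].  There [`|z - b| ^+ 2 = s ^+ 2 = (1 - c) * (1 + c)], whereas
    [`|u - b| ^+ 2 = 2 * (1 - c)].  The latter is strictly larger since [c < 1],
    which leaves room to choose [c] so that [h ^+ 2] lies strictly between the
    two ([cosine_between]). *)

(** With [t = 1 - c] the bounds read [2 * t - t ^+ 2 < h ^+ 2 < 2 * t]: the
    number [t] must exceed [h ^+ 2 / 2], but by a correction of order
    [h ^+ 4] small enough for [t ^+ 2] to absorb. *)
Lemma cosine_between (R : realFieldType) (h : R) : 0 < h -> h < 1 ->
  exists c : R, [/\ 0 < c, c < 1, 1 - c ^+ 2 < h ^+ 2 & h ^+ 2 < 2 * (1 - c)].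
Proof.
move=> h_gt0 h_lt1; exists (1 - (h ^+ 2 / 2 + h ^+ 4 / 8)).
have k_gt0 : 0 < h ^+ 2 by rewrite exprn_gt0.
have k_lt1 : h ^+ 2 < 1 by rewrite exprn_ilt1 // ltW.
rewrite (_ : h ^+ 4 = h ^+ 2 * h ^+ 2); last by ring.
move: (h ^+ 2) k_gt0 k_lt1 => k k_gt0 k_lt1.
have k2_gt0 : 0 < k * k by rewrite mulr_gt0.
have k2_lt : k * k < k by rewrite gtr_pMl.
have k3_gt0 : 0 < k * k * k by rewrite mulr_gt0.
have k4_gt0 : 0 < k * k * (k * k) by rewrite mulr_gt0.
by split; nra.
Qed.

Lemma complex_norm_lt (R : rcfType) (x y h : R) : 0 < h ->
  x ^+ 2 + y ^+ 2 < h ^+ 2 -> `|x +i* y| < h%:C.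
Proof.
move=> h_gt0 lt_h; rewrite normc_def ltcR.
by rewrite -[ltRHS]ger0_norm ?ltW // -sqrtr_sqr ltr_sqrt ?exprn_gt0.
Qed.

Lemma complex_norm_gt (R : rcfType) (x y h : R) : 0 < h ->
  h ^+ 2 < x ^+ 2 + y ^+ 2 -> h%:C < `|x +i* y|.
Proof.
move=> h_gt0 lt_h; rewrite normc_def ltcR.
rewrite -[ltLHS]ger0_norm ?ltW // -sqrtr_sqr ltr_sqrt //.
by apply: lt_trans lt_h; rewrite exprn_gt0.
Qed.

(** By the triangle inequality, the ball of radius [`|w - b| - h] around [w]
    would miss the Carleson set.  Refuting the strict inequality, rather than
    proving [`|w - b| <= h%:C], avoids comparability side conditions in the
    partially ordered [R[i]]. *)
Lemma closure_carleson_set_norm (R : realType) (b w : R[i]) (h : R) :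
  closure (carleson_set b h : set R[i]^o) w -> ~ (h%:C < `|w - b|).
Proof.
move=> clw far.
have e_gt0 : 0 < `|w - b| - h%:C by rewrite subr_gt0.
have [z [[_ zb] wz]] := clw _ (nbhsx_ballx (w : R[i]^o) _ e_gt0).
have := wz; rewrite -ball_normE /= => {}wz.
have := ltrD wz zb; rewrite subrK => lt_sum.
have := le_lt_trans (ler_normD (w - z) (z - b)) lt_sum.
by rewrite addrA subrK ltxx.
Qed.

Theorem proposition1p1 (R : realType) (b : R[i]) (h : R)
    (hb : unit_circle b) (h_gt0 : 0 < h) (h_lt1 : h < 1) :
  ~ (carleson_set b h `<=` carleson_window b h).
Proof.
have [c [c_gt0 c_lt1 near_foot far_proj]] := cosine_between R h h_gt0 h_lt1.
pose s := Num.sqrt (1 - c ^+ 2); pose v := c +i* s.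
have s2 : s ^+ 2 = 1 - c ^+ 2.
  by rewrite sqr_sqrtr // subr_ge0 exprn_ile1 // ltW.
have norm_b : `|b| = 1 := hb.
have norm_v : `|v| = 1 by rewrite normc_def s2 addrC subrK sqrtr1.
have norm_u : `|b * v| = 1 by rewrite normrM norm_b norm_v mulr1.
have cC_gt0 : 0 < c%:C by rewrite ltcR.
have norm_z : `|c%:C * (b * v)| = c%:C.
  by rewrite normrM norm_u mulr1 gtr0_norm.
have norm_sub x : `|b * x - b| = `|x - 1|.
  by rewrite -{2}[b]mulr1 -mulrBr normrM norm_b mul1r.
move=> /(_ (c%:C * (b * v)))[|_ _].
  split; first by rewrite /unit_disk /= norm_z ltcR.
  rewrite mulrCA norm_sub.
  rewrite (_ : c%:C * v - 1 = (c ^+ 2 - 1) +i* (c * s)); last first.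
    by apply/eqP; rewrite eq_complex /=; apply/andP; split; apply/eqP; ring.
  apply: complex_norm_lt => //; rewrite exprMn s2.
  by rewrite (_ : _ + _ = 1 - c ^+ 2) //; ring.
(* The window would put the projection [b * v] in the closure. *)
rewrite norm_z mulrAC divff ?gt_eqF // mul1r.
move=> /closure_carleson_set_norm; apply; rewrite norm_sub.
rewrite (_ : v - 1 = (c - 1) +i* s); last first.
  by apply/eqP; rewrite eq_complex /=; apply/andP; split; apply/eqP; ring.
apply: complex_norm_gt => //; rewrite s2.
lra.
Qed.
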